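(* Let $A \in \mathbb{C}^{d\times d}$, $\phi \in \mathbb{C}^d$ and $L \in \mathbb{N}$ be such that $\{A^\ell \phi\}_{\ell=0}^{L-1}$ is a frame for $\mathbb{C}^d$, and let $\alpha_1, \alpha_2 \in \mathbb{R}$ satisfy $\alpha_1 - \alpha_2 \notin \pi\mathbb{Z}$. Then almost all $x \in \mathbb{C}^d$ can be recovered up to global phase from the samples $$\bigl\{ |\langle x, A^\ell \phi \rangle| \bigr\}_{\ell=0}^{L-1} \cup \bigl\{ |\langle x, A^\ell (\phi + e^{\mathrm{i}\alpha_k} A\phi) \rangle| \bigr\}_{\ell=0,\,k=1}^{L-2,\,2}.$$
   Context: A finite family of vectors is a frame for $\mathbb{C}^d$ if it spans $\mathbb{C}^d$. $\langle\cdot,\cdot\rangle$ is the standard Hermitian inner product on $\mathbb{C}^d$, linear in the first argument. The samples are indexed families: the values $|\langle x, A^\ell \phi\rangle|$ for each $\ell \in \{0,\dots,L-1\}$ and the values $|\langle x, A^\ell(\phi + e^{\mathrm{i}\alpha_k}A\phi)\rangle|$ for each $\ell\in\{0,\dots,L-2\}$ and $k\in\{1,2\}$ are known together with their indices; $A$, $\phi$, $\alpha_1$, $\alpha_2$ are known. A vector $x$ ''can be recovered up to global phase'' from the samples if every $y \in \mathbb{C}^d$ having the same samples as $x$ is of the form $y = e^{\mathrm{i}\theta}x$ for some $\theta\in\mathbb{R}$. ''Almost all'' means all $x$ outside a set of Lebesgue measure zero. *)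

(* Defs.v *)
From HB Require Import structures.
From mathcomp Require Import all_boot all_order all_algebra.
From mathcomp Require Import complex.
From mathcomp Require Import all_classical all_reals all_analysis.

Set Implicit Arguments.
Unset Strict Implicit.
Unset Printing Implicit Defensive.

Import Order.TTheory GRing.Theory Num.Theory.
Import numFieldNormedType.Exports.

Local Open Scope classical_set_scope.
Local Open Scope complex_scope.
Local Open Scope ring_scope.

Definition tcons (T : Type) (n : nat) (p : T * n.-tuple T) : n.+1.-tuple T :=
  [tuple of p.1 :: p.2].

Lemma measurable_tcons d (T : measurableType d) n :
  measurable_fun [set: T * n.-tuple T] (@tcons T n).
Proof. exact: measurable_cons. Qed.

Section tcons_measure.
Context (d : measure_display) (T : measurableType d) (R : realType) (n : nat).
Variable mu : {sigma_finite_measure set T -> \bar R}.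
Variable nu : {sigma_finite_measure set (n.-tuple T) -> \bar R}.

Definition tcons_measure : set (n.+1.-tuple T) -> \bar R :=
  pushforward (mu \x nu)%E (@tcons T n).

Let mtcons := @measurable_tcons _ T n.

Let tcons_measure0 : tcons_measure set0 = 0%E.
Proof. exact: measure0. Qed.

Let tcons_measure_ge0 A : (0 <= tcons_measure A)%E.
Proof. exact: measure_ge0. Qed.

Let tcons_measure_sigma_additive : semi_sigma_additive tcons_measure.
Proof. exact: measure_semi_sigma_additive. Qed.

HB.instance Definition _ := isMeasure.Build _ _ _ tcons_measure
  tcons_measure0 tcons_measure_ge0 tcons_measure_sigma_additive.

Let tcons_measure_sigma_finite : sigma_finite setT tcons_measure.
Proof.
have /sigma_finiteP[F [FT ndF Foo]] := sigma_finiteT mu.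
have /sigma_finiteP[G [GT ndG Goo]] := sigma_finiteT nu.
pose tl (t : n.+1.-tuple T) : n.-tuple T := [tuple of behead t].
exists (fun k => [set t | F k (tnth t ord0) /\ G k (tl t)]).
  apply/esym/seteqP; split=> // t _.
  have [k _ Fk] : (\bigcup_k F k) (tnth t ord0) by rewrite -FT.
  have [l _ Gl] : (\bigcup_k G k) (tl t) by rewrite -GT.
  exists (maxn k l) => //; split.
    by move: Fk; exact/subsetPset/ndF/leq_maxl.
  by move: Gl; exact/subsetPset/ndG/leq_maxr.
move=> k; have [mF Fk] := Foo k; have [mG Gk] := Goo k; split.
  apply: measurableI.
    rewrite -[X in measurable X]setTI.
    exact: (@measurable_tnth _ T n.+1 ord0).
  by rewrite -[X in measurable X]setTI; exact: (@measurable_behead _ T n).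
rewrite /tcons_measure /pushforward.
rewrite (_ : _ @^-1` _ = F k `*` G k).
  by rewrite product_measure1E// lte_mul_pinfty// ge0_fin_numE.
apply/seteqP; split=> -[x t] /= [Fx Gt]; split=> //; move: Gt;
  by rewrite (_ : tl _ = t)//; apply: val_inj.
Qed.

HB.instance Definition _ := Measure_isSigmaFinite.Build _ _ _
  tcons_measure tcons_measure_sigma_finite.

End tcons_measure.

Fixpoint lebesgue_tuple (R : realType) (n : nat) :
    {sigma_finite_measure set (n.-tuple (measurableTypeR R)) -> \bar R} :=
  if n is m.+1 then tcons_measure lebesgue_measure (lebesgue_tuple R m)
  else \d_([tuple] : 0.-tuple (measurableTypeR R)).

Lemma lebesgue_tuple_box (R : realType) (n : nat)
    (B : 'I_n -> set (measurableTypeR R)) :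
  (forall i, measurable (B i)) ->
  lebesgue_tuple R n [set t | forall i, B i (tnth t i)] =
  (\prod_(i < n) lebesgue_measure (B i))%E.
Proof.
elim: n B => [|n IH] B mB.
  by rewrite big_ord0 /= diracE mem_set//=; case.
rewrite big_ord_recl -(IH (fun i => B (lift ord0 i)))//.
rewrite -product_measure1E//=; last first.
  rewrite (_ : mkset _ = \bigcap_(i in [set: 'I_n])
    ((@tnth _ _)^~ i @^-1` B (lift ord0 i))).
    apply: fin_bigcap_measurable => // i _.
    by rewrite -[X in measurable X]setTI; apply: measurable_tnth.
  by apply/seteqP; split=> t /= h i; [move=> _; exact: h|exact: (h i I)].
rewrite /tcons_measure/= /pushforward; congr (product_measure1 _ _ _).
apply/seteqP; split=> -[x t] /=.
  move=> h; split; first exact: (h ord0).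
  by move=> i; have := h (lift ord0 i); rewrite tnthS.
by case=> hx ht i; case: (unliftP ord0 i) => [j|] ->; rewrite ?tnthS.
Qed.

(* C^d is identified with R^(d + d): the real parts of the d coordinates first,
   then the imaginary parts. *)
Definition cvec (R : realType) (d : nat)
    (t : (d + d).-tuple (measurableTypeR R)) : 'cV[R[i]]_d :=
  \col_j (tnth t (lshift d j) +i* tnth t (rshift d j)).

Definition almost_all (R : realType) (d : nat) (P : 'cV[R[i]]_d -> Prop) : Prop :=
  {ae lebesgue_tuple R (d + d), forall t, P (cvec t)}.

Definition inner (C : numClosedFieldType) (d : nat) (x y : 'cV[C]_d) : C :=
  dotmx x^T y^T.

Lemma innerE (C : numClosedFieldType) d (x y : 'cV[C]_d) :
  inner x y = \sum_i x i 0 * (y i 0)^*%R.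
Proof. by rewrite /inner dotmxE !mxE; apply: eq_bigr => i _; rewrite !mxE. Qed.

Definition is_frame (C : fieldType) (d n : nat) (f : 'I_n -> 'cV[C]_d) : Prop :=
  (<<codom f>> = fullv)%VS.

Definition expi (R : realType) (t : R) : R[i] := cos t +i* sin t.

(* With the convention 0.-1 = 0, 'I_L.-1 is the index set {0, ..., L - 2}, empty
   when L <= 1. *)
Definition samples (R : realType) (d L : nat) (A : 'M[R[i]]_d)
    (phi : 'cV[R[i]]_d) (alpha : 'I_2 -> R) (x : 'cV[R[i]]_d) :
    {ffun 'I_L -> R[i]} * {ffun 'I_L.-1 * 'I_2 -> R[i]} :=
  ([ffun l : 'I_L => `|inner x (A ^+ l *m phi)|],
   [ffun lk : 'I_L.-1 * 'I_2 =>
      `|inner x (A ^+ lk.1 *m (phi + expi (alpha lk.2) *: (A *m phi)))|]).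

Definition recoverable_up_to_phase (R : realType) (d : nat) (S : Type)
    (s : 'cV[R[i]]_d -> S) (x : 'cV[R[i]]_d) : Prop :=
  forall y : 'cV[R[i]]_d, s y = s x -> exists theta : R, y = expi theta *: x.

(* Main.v *)
Require Import Defs.
From HB Require Import structures.
From mathcomp Require Import all_boot all_order all_algebra.
From mathcomp Require Import complex.
From mathcomp Require Import all_classical all_reals all_analysis.
From mathcomp Require Import measurable_realfun ring lra.

Set Implicit Arguments.
Unset Strict Implicit.
Unset Printing Implicit Defensive.

Import Order.TTheory GRing.Theory Num.Theory.
Import numFieldNormedType.Exports.

Local Open Scope complex_scope.
Local Open Scope ring_scope.

(** Write [a_l = <x, A^l phi>], so that [<x, A^l (phi + e^(i alpha_k) A phi)>]
is [a_l + e^(-i alpha_k) a_(l+1)].  Expanding the squared modulus of the latter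
and subtracting the known [|a_l|^2] and [|a_(l+1)|^2] leaves
[Re (e^(-i alpha_k) conj(a_l) a_(l+1))].  For [k = 1, 2] these are two real
linear equations in the real and imaginary parts of [conj(a_l) a_(l+1)], with
determinant [sin (alpha_1 - alpha_2)] up to sign, and the determinant does not
vanish because [alpha_1 - alpha_2] is not a multiple of pi.  Hence the samples
determine every product [conj(a_l) a_(l+1)]
([interference_relative_phase]).

Let [y] have the same samples as [x], and put [b_l = <y, A^l phi>].  As long as
the [a_l] do not vanish, the equalities
[conj(b_l) b_(l+1) = conj(a_l) a_(l+1)] propagate one unimodular factor [u]
with [b_l = u a_l] along the sequence ([eq_up_to_phase]).  An index with
[A^l phi = 0] is harmless: all later vectors of the orbit then vanish as well,
so both sequences are zero from there on.  Since the vectors [A^l phi] span the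
space, [y - u x] is orthogonal to everything, that is, [y = u x]
([frame_inner_eq0]).

The exceptional [x] are thus among those orthogonal to some nonzero [A^l phi].  For
each of the finitely many [l], such an [x] lies in the real hyperplane
[Re <x, A^l phi> = 0] of [R^(2d)], and hyperplanes are Lebesgue-null by Fubini
and induction on the dimension ([lebesgue_hyperplane0]). *)

(** * Hyperplanes are Lebesgue-null *)

Lemma measurable_hyperplane (R : realType) n (c : 'I_n -> R) (b : R) :
  measurable [set t : n.-tuple (measurableTypeR R) |
    \sum_i c i * tnth t i = b].
Proof.
have mf : measurable_fun [set: n.-tuple (measurableTypeR R)]
    (fun t => \sum_i c i * tnth t i : measurableTypeR R).
  apply: measurable_sum => i.
  apply: measurable_funM => //.
  exact: (@measurable_tnth _ (measurableTypeR R) n i).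
by rewrite -[X in measurable X]setTI; exact: (mf measurableT _ (measurable_set1 b)).
Qed.

(** An affine hyperplane has measure zero.  The constant term [b] is needed
because the sections along the first coordinate of a hyperplane are parallel
hyperplanes of one dimension less. *)
Lemma lebesgue_hyperplane0 (R : realType) n (c : 'I_n -> R) (b : R) :
  (exists i, c i != 0) ->
  lebesgue_tuple R n [set t : n.-tuple (measurableTypeR R) |
    \sum_i c i * tnth t i = b]%classic = 0%E.
Proof.
elim: n c b => [c b [[]]//|n IH c b [i0 ci0]].
rewrite /= /tcons_measure /pushforward.
have [/existsP[j cj]|/existsPn c'0] :=
    boolP [exists j : 'I_n, c (lift ord0 j) != 0].
  rewrite /product_measure1 integral0_eq// => x _ /=.
  rewrite -[RHS](IH (fun j => c (lift ord0 j)) (b - c ord0 * x));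
    last by exists j.
  congr (lebesgue_tuple R n _); apply/seteqP; split=> t.
    rewrite /xsection/= inE/= big_ord_recl tnth0 => <-.
    by rewrite addrC addKr; apply: eq_bigr => k _; rewrite tnthS.
  rewrite /xsection/= inE/= big_ord_recl tnth0 => E.
  rewrite -[RHS](subrK (c ord0 * x)) -E addrC; congr (_ + _).
  by apply: eq_bigr => k _; rewrite tnthS.
(* Otherwise the hyperplane is orthogonal to the first axis, and equal to the
   product of a point and the whole space. *)
have c0 : c ord0 != 0.
  case: (unliftP ord0 i0) ci0 => [k|] -> // /negP.
  by have := c'0 k; rewrite negbK => ->.
rewrite (_ : (_ @^-1` _ = [set b / c ord0] `*` setT)%classic).
  by rewrite product_measure1E//= lebesgue_measure_set1 mul0e.
have E x (t : n.-tuple (measurableTypeR R)) :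
    \sum_i c i * tnth (tcons (x, t)) i = c ord0 * x.
  rewrite big_ord_recl tnth0 big1 ?addr0// => k _.
  by have := c'0 k; rewrite negbK => /eqP ->; rewrite mul0r.
apply/seteqP; split=> -[x t] /=; rewrite E.
  by move=> <-; split=> //; rewrite mulrAC divff// mul1r.
by case=> -> _; rewrite mulrCA divff// mulr1.
Qed.

(** * Trigonometry and unimodular numbers *)

Lemma sin_mulpi_nat (R : realType) n : sin (pi * n%:R : R) = 0.
Proof.
have := alternatingn (@sinDpi R) n 0.
by rewrite add0r sin0 mulr0 mulr_natr.
Qed.

Lemma sin_eq0_mulpi (R : realType) (x : R) :
  sin x = 0 -> exists m : int, x = pi * m%:~R.
Proof.
move=> sx; pose m := Num.floor (x / pi); exists m.
have smpi : sin (pi * m%:~R : R) = 0.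
  case: (m) => k; first exact: sin_mulpi_nat.
  by rewrite NegzE mulrNz mulrN sinN -pmulrn sin_mulpi_nat oppr0.
(* The remainder [x - m pi] lies in [0, pi), where sin vanishes only at 0. *)
have pi0 := pi_gt0 R.
have /andP[h1 h2] : 0 <= x - pi * m%:~R < pi.
  have /andP[] := floor_itv (x / pi); rewrite -/m intrD.
  rewrite ler_pdivlMr// ltr_pdivrMr// => h1 h2; apply/andP; split; lra.
apply/eqP; rewrite -subr_eq0 eq_le h1 andbT leNgt; apply/negP => h.
have := @sin_gt0_pi R (x - pi * m%:~R); rewrite h h2 => /(_ isT).
by rewrite sinB sx smpi mul0r mulr0 subrr ltxx.
Qed.

Lemma norm1_expi (R : realType) (u : R[i]) :
  `|u| = 1 -> exists theta : R, u = expi theta.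
Proof.
case: u => p q u1.
have pq : p ^+ 2 + q ^+ 2 = 1.
  by apply: (@complexI R); rewrite (add_Re2_Im2 (p +i* q)) u1 expr1n.
have p1 : -1 <= p <= 1.
  rewrite -ler_norml -(@expr_le1 _ 2)//.
  by rewrite real_normK ?num_real// -pq lerDl sqr_ge0.
have sin_p : sin (acos p) = `|q|.
  by rewrite sin_acos// -pq addrC addKr sqrtr_sqr.
have cos_p : cos (acos p) = p by rewrite acosK// in_itv.
rewrite /expi; have [q0|q0] := leP 0 q.
  by exists (acos p); rewrite cos_p sin_p ger0_norm.
by exists (- acos p); rewrite cosN sinN cos_p sin_p ltr0_norm// opprK.
Qed.

(** * The inner product and frames *)

Lemma innerDZr (C : numClosedFieldType) d (x u v : 'cV[C]_d) (e : C) :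
  inner x (u + e *: v) = inner x u + e^*%R * inner x v.
Proof.
rewrite !innerE mulr_sumr -big_split; apply: eq_bigr => i _ /=.
by rewrite !mxE rmorphD rmorphM mulrDr [RHS]/=; congr (_ + _); rewrite mulrCA.
Qed.

Lemma innerBl (C : numClosedFieldType) d (x y v : 'cV[C]_d) (u : C) :
  inner (y - u *: x) v = inner y v - u * inner x v.
Proof.
rewrite !innerE mulr_sumr -sumrB; apply: eq_bigr => i _ /=.
by rewrite !mxE mulrBl mulrA.
Qed.

Lemma inner0r (C : numClosedFieldType) d (x : 'cV[C]_d) : inner x 0 = 0.
Proof. by rewrite innerE big1// => i _; rewrite mxE rmorph0 mulr0. Qed.

(** A vector orthogonal to every vector of a frame is zero. *)
Lemma frame_inner_eq0 (C : numClosedFieldType) d n (f : 'I_n -> 'cV[C]_d) z :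
  is_frame f -> (forall i, inner z (f i) = 0) -> z = 0.
Proof.
move=> ff z0; have zv v : inner z v = 0.
  have : v \in <<codom_tuple f>>%VS by rewrite ff memvf.
  move=> /coord_span ->.
  have innerS (s : seq 'I_#|'I_n|) (a : _ -> C) :
      inner z (\sum_(i <- s) a i *: (codom_tuple f)`_i) = 0.
    elim: s => [|i s IH]; first by rewrite big_nil inner0r.
    rewrite big_cons addrC innerDZr IH add0r.
    have /codomP[j ->] : (codom_tuple f)`_i \in codom f.
      by rewrite -tnth_nth; exact: (mem_tnth i (codom_tuple f)).
    by rewrite z0 mulr0.
  exact: innerS.
apply/colP => i; rewrite [RHS]mxE -(zv (delta_mx i 0)) innerE (bigD1 i)//= big1.
  by rewrite !mxE !eqxx rmorph1 mulr1 addr0.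
by move=> j ji; rewrite !mxE (negbTE ji) rmorph0 mulr0.
Qed.

(** * Recovery of the phases *)

(** The relative phase of two complex numbers, encoded by [conj(z) w], is
determined by their moduli and by the moduli of two of their
superpositions. *)
Lemma interference_relative_phase (R : realType) (al be : R) (z w z' w' : R[i]) :
  sin (al - be) != 0 -> `|z'| = `|z| -> `|w'| = `|w| ->
  `|z' + (expi al)^*%R * w'| = `|z + (expi al)^*%R * w| ->
  `|z' + (expi be)^*%R * w'| = `|z + (expi be)^*%R * w| ->
  z'^*%R * w' = z^*%R * w.
Proof.
move=> s0 nz nw Ha Hb.
have sq (p q : R[i]) : `|p| = `|q| ->
    complex.Re p ^+ 2 + complex.Im p ^+ 2 = complex.Re q ^+ 2 + complex.Im q ^+ 2.
  by move=> pq; apply: (@complexI R); rewrite !add_Re2_Im2 pq.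
move: nz nw Ha Hb => /sq nz /sq nw /sq Ha /sq Hb.
case: z w z' w' nz nw Ha Hb => [a b] [c d] [a' b'] [c' d'] /= nz nw.
have := cos2Dsin2 al; have := cos2Dsin2 be; move: s0; rewrite sinB.
set ca := cos al; set sa := sin al; set cb := cos be; set sb := sin be.
move=> s0 eb ea Ha Hb.
(* [X] and [Y] are the real and imaginary parts of [conj(z') w' - conj(z) w]. *)
pose X := a' * c' + b' * d' - (a * c + b * d).
pose Y := a' * d' - b' * c' - (a * d - b * c).
have expand (k s p q r t : R) : k ^+ 2 + s ^+ 2 = 1 ->
    (p + (k * r - - s * t)) ^+ 2 + (q + (k * t + - s * r)) ^+ 2 =
    p ^+ 2 + q ^+ 2 + (r ^+ 2 + t ^+ 2) +
    2 * (k * (p * r + q * t) + s * (p * t - q * r)).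
  move=> ks; rewrite -[r ^+ 2 + t ^+ 2 in RHS]mul1r.
  by rewrite -[X in X * (r ^+ 2 + t ^+ 2)]ks; ring.
move: Ha Hb; rewrite !expand// => Ha Hb.
have XYa : ca * X + sa * Y = 0 by rewrite /X /Y; lra.
have XYb : cb * X + sb * Y = 0 by rewrite /X /Y; lra.
have X0 : X = 0.
  apply: (mulfI s0); rewrite mulr0.
  transitivity (sa * (cb * X + sb * Y) - sb * (ca * X + sa * Y)); first by ring.
  by rewrite XYa XYb !mulr0 subrr.
have Y0 : Y = 0.
  apply: (mulfI s0); rewrite mulr0.
  transitivity (cb * (ca * X + sa * Y) - ca * (cb * X + sb * Y)); first by ring.
  by rewrite XYa XYb !mulr0 subrr.
apply/eqP; rewrite eq_complex /=; apply/andP; split; apply/eqP.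
  by move: X0; rewrite /X; lra.
by move: Y0; rewrite /Y; lra.
Qed.

(** The equality of the consecutive products forces [b] to be [a] times one
unimodular number.  Once [a] vanishes it has to vanish forever, since a zero
of [a] would otherwise decouple the phases on its two sides. *)
Lemma eq_up_to_phase (C : numClosedFieldType) L (a b : nat -> C) :
  (forall l, (l < L)%N -> `|b l| = `|a l|) ->
  (forall l, (l.+1 < L)%N -> (b l)^*%R * b l.+1 = (a l)^*%R * a l.+1) ->
  (forall l, (l.+1 < L)%N -> a l = 0 -> a l.+1 = 0) ->
  exists2 u : C, `|u| = 1 & forall l, (l < L)%N -> b l = u * a l.
Proof.
move=> absba ba a_eq0.
have [L0|L_gt0] := posnP L; first by exists 1; [exact: normr1|rewrite L0].
(* If [a 0 = 0], both sequences vanish and any unimodular number will do. *)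
pose u := if a 0%N == 0 then 1 else b 0%N / a 0%N.
have u1 : `|u| = 1.
  rewrite /u; case: eqVneq => [_|a0]; first exact: normr1.
  by rewrite normrM normfV absba// divff// normr_eq0.
have ba0 l : (l < L)%N -> a l = 0 -> b l = u * a l.
  by move=> lL al0; apply/eqP; rewrite al0 mulr0 -normr_eq0 absba// al0 normr0.
exists u => //; elim=> [_|l IH lL].
  have [a0|a0] := eqVneq (a 0%N) 0; first exact: ba0.
  by rewrite /u (negbTE a0) divfK.
have [al0|al0] := eqVneq (a l) 0; first by apply: ba0 => //; exact: a_eq0.
have uu : u * u^*%R = 1 by rewrite -normCK u1 expr1n.
apply: (mulfI (_ : (a l)^*%R != 0)); first by rewrite conjC_eq0.
by rewrite [RHS]mulrCA -ba// (IH (ltnW lL)) rmorphM !mulrA uu mul1r.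
Qed.

(** * Almost every vector *)

Lemma ae_inner_neq0 (R : realType) d (v : 'cV[R[i]]_d) :
  v != 0 -> almost_all (fun x => inner x v != 0).
Proof.
move=> v0.
(* [c] holds the coordinates in R^(d + d) of the normal vector of the real
   hyperplane [Re <x, v> = 0]. *)
pose c (k : 'I_(d + d)) : R := match fintype.split k with
  | inl j => complex.Re (v j 0) | inr j => complex.Im (v j 0) end.
have Rein (t : (d + d).-tuple (measurableTypeR R)) :
    complex.Re (inner (cvec t) v) = \sum_k c k * tnth t k.
  rewrite innerE big_split_ord/= -big_split/= raddf_sum.
  apply: eq_bigr => j _; rewrite /c.
  rewrite (unsplitK (inl j)) (unsplitK (inr j)) mxE.
  by case: (v j 0) => p q /=; ring.
have c0 : exists k, c k != 0.
  have /cV0Pn[j vj] := v0; move: vj; rewrite eq_complex negb_and => /orP[h|h].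
    by exists (lshift d j); rewrite /c (unsplitK (inl j)).
  by exists (rshift d j); rewrite /c (unsplitK (inr j)).
apply: negligibleS (iffRL (negligibleP _ (measurable_hyperplane c 0))
  (lebesgue_hyperplane0 0 c0)).
move=> t /= /negP; rewrite negbK => /eqP h.
by rewrite -Rein h.
Qed.

Lemma almost_allS (R : realType) d (P Q : 'cV[R[i]]_d -> Prop) :
  (forall x, P x -> Q x) -> almost_all P -> almost_all Q.
Proof. by move=> PQ; rewrite /almost_all; apply: filterS => t; exact: PQ. Qed.

Lemma almost_all_forall (R : realType) d (I : finType)
    (P : I -> 'cV[R[i]]_d -> Prop) :
  (forall k, almost_all (P k)) -> almost_all (fun x => forall k, P k x).
Proof.
move=> aeP; rewrite /almost_all.
apply: (@filter_forall _ _ (fun k t => P k (cvec t))) => k.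
exact: aeP.
Qed.

(** * The samples *)

Lemma samples1E (R : realType) (d L : nat) (A : 'M[R[i]]_d)
    (phi : 'cV[R[i]]_d) (alpha : 'I_2 -> R) x (l : 'I_L) :
  (samples L A phi alpha x).1 l = `|inner x (A ^+ l *m phi)|.
Proof. exact: ffunE. Qed.

(** The inner product is conjugate-linear in its second argument, whence the
conjugate of [e^(i alpha_k)]. *)
Lemma samples2E (R : realType) (d L : nat) (A : 'M[R[i]]_d)
    (phi : 'cV[R[i]]_d) (alpha : 'I_2 -> R) x (l : 'I_L.-1) (k : 'I_2) :
  (samples L A phi alpha x).2 (l, k) =
  `|inner x (A ^+ l *m phi) +
    (expi (alpha k))^*%R * inner x (A ^+ l.+1 *m phi)|.
Proof.
rewrite exprSr -[(A ^+ l * A) *m phi]mulmxA -innerDZr scalemxAr -mulmxDr.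
exact: ffunE.
Qed.

Theorem theorem5p1 (R : realType) (d L : nat) (A : 'M[R[i]]_d)
    (phi : 'cV[R[i]]_d) (alpha : 'I_2 -> R) :
  is_frame (fun l : 'I_L => A ^+ l *m phi) ->
  ~ (exists m : int, alpha 0 - alpha 1 = pi * m%:~R) ->
  almost_all (fun x => recoverable_up_to_phase (samples L A phi alpha) x).
Proof.
move=> frame_f nalpha.
have s0 : sin (alpha 0 - alpha 1) != 0 by apply/eqP => /sin_eq0_mulpi.
have : almost_all (fun x => forall l : 'I_L,
    A ^+ l *m phi != 0 -> inner x (A ^+ l *m phi) != 0).
  apply: almost_all_forall => l.
  have [->|v0] := eqVneq (A ^+ l *m phi) 0; first exact: aeW.
  by apply: almost_allS (ae_inner_neq0 v0) => x h _.
apply: almost_allS => x x0 y yx.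
pose a l := inner x (A ^+ l *m phi); pose b l := inner y (A ^+ l *m phi).
have absba (l : nat) : (l < L)%N -> `|b l| = `|a l|.
  move=> lL.
  have E z : (samples L A phi alpha z).1 (Ordinal lL) =
    `|inner z (A ^+ l *m phi)| := samples1E A phi alpha z _.
  by rewrite -[LHS](E y) -[RHS](E x) yx.
have ba l : (l.+1 < L)%N -> (b l)^*%R * b l.+1 = (a l)^*%R * a l.+1.
  move=> lL; have lL1 : (l < L.-1)%N by case: (L) lL.
  have H (k : 'I_2) : `|b l + (expi (alpha k))^*%R * b l.+1| =
                      `|a l + (expi (alpha k))^*%R * a l.+1|.
    have E z : (samples L A phi alpha z).2 (Ordinal lL1, k) =
        `|inner z (A ^+ l *m phi) +
          (expi (alpha k))^*%R * inner z (A ^+ l.+1 *m phi)| :=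
      samples2E A phi alpha z _ _.
    by rewrite -[LHS](E y) -[RHS](E x) yx.
  by apply: interference_relative_phase s0 (absba _ (ltnW lL)) (absba _ lL) _ _.
have a0 l : (l.+1 < L)%N -> a l = 0 -> a l.+1 = 0.
  move=> /ltnW lL al0; have [v0|] := eqVneq (A ^+ l *m phi) 0.
    by rewrite /a exprS -mulmxA v0 mulmx0 inner0r.
  have x0l : A ^+ l *m phi != 0 -> a l != 0 := x0 (Ordinal lL).
  by move=> /x0l/eqP/(_ al0)[].
have [u u1 bu] := eq_up_to_phase absba ba a0.
have [th uth] := norm1_expi u1; exists th; rewrite -uth.
apply/eqP; rewrite -subr_eq0; apply/eqP.
apply: (frame_inner_eq0 frame_f) => l.
by rewrite innerBl; apply/eqP; rewrite subr_eq0; apply/eqP/bu/ltn_ord.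
Qed.
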